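(* Let $\mu$ be any probability measure on $\mathbb{R}$ with a continuous strictly increasing cumulative distribution function $F$ such that for all $\varepsilon>0$ $$\lim_{t\to\infty}\frac{1-F(t+\varepsilon)}{1-F(t)}=\lim_{t\to-\infty}\frac{F(t)}{F(t+\varepsilon)}=0.$$ Then there exists a sequence $(\delta_n)_{n=1}^{\infty}$ with $\lim_{n\to\infty}\delta_n=0$ such that for all $n\in\mathbb{N}$, if $(x_i)_{i=1}^n$ is an i.i.d. sample from $\mu$ with corresponding order statistics $(x_{(i)})_{i=1}^n$, then with probability at least $1-\delta_n$, $$\sup_{1\le i\le n}|x_{(i)}-x_{(i)}^{*}|\le\delta_n,$$ where $x_{(i)}^{*}=F^{-1}(i/(n+1))$.
   Context: $\mathbb{N}=\{1,2,3,\dots\}$. The order statistics $x_{(1)}\le x_{(2)}\le\dots\le x_{(n)}$ are the sample values arranged in non-decreasing order. $F$ is strictly increasing on all of $\mathbb{R}$, and $F^{-1}:(0,1)\to\mathbb{R}$ is its inverse function. *)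

(* Defs.v *)
From HB Require Import structures.
From mathcomp Require Import all_boot all_order all_algebra.
From mathcomp Require Import all_classical all_reals all_analysis.

Set Implicit Arguments.
Unset Strict Implicit.
Unset Printing Implicit Defensive.

Import Order.TTheory GRing.Theory Num.Theory.
Import numFieldNormedType.Exports.

Local Open Scope classical_set_scope.
Local Open Scope ring_scope.

Definition cdf_of (R : realType) (mu : probability (measurableTypeR R) R)
    (t : R) : R :=
  fine (mu `]-oo, t]%classic).

(* For a strictly increasing continuous cumulative distribution function F,
   range F is the open interval ]0, 1[ and [inverse_cdf mu] is there the inverse
   of F; elsewhere its value is arbitrary. *)
Definition inverse_cdf (R : realType) (mu : probability (measurableTypeR R) R)
    : R -> R :=
  pinv [set: R] (cdf_of mu).

Definition mutually_independent (d : measure_display) (T : measurableType d)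
    (R : realType) (P : probability T R) (I : finType)
    (X : I -> {RV P >-> R}) : Prop :=
  forall (J : {set I}) (B : I -> set R), (forall i, measurable (B i)) ->
    P (\bigcap_(i in [set` J]) X i @^-1` B i) =
    (\prod_(i in J) P (X i @^-1` B i))%E.

Definition iid_sample (d : measure_display) (T : measurableType d)
    (R : realType) (P : probability T R)
    (mu : probability (measurableTypeR R) R) (n : nat)
    (X : 'I_n -> {RV P >-> R}) : Prop :=
  mutually_independent X /\
  forall (i : 'I_n) (B : set R), measurable B -> distribution P (X i) B = mu B.

(* Numbered from 1: x_(1) <= ... <= x_(n) for k = 1, ..., n. *)
Definition order_statistic (R : realType) (n : nat) (x : 'I_n -> R) (k : nat)
    : R :=
  nth 0 (sort <=%R (codom x)) k.-1.

(* Main.v *)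
(* Write q_k for the quantile F^{-1}(k / (n+1)). The order statistic x_(k)
   exceeds q_k + e exactly when fewer than k sample points lie in
   ]-oo, q_k + e], and x_(k) < q_k - e forces fewer than n + 1 - k of them to lie
   in ]q_k - e, +oo[. For r the probability of the set in question, the number
   of points in it is binomial, and Chernoff's bound
   P(N < k) <= (1 - r + z r)^n / z^(k-1), 0 < z <= 1, controls both events
   through the comparison of u = k / (n+1) with r: in the tails the hypotheses
   make u / r or (1 - r) / (1 - u) at most a given rho, and the bound is
   (8 rho)^k or (8 rho)^(n+1-k); in between, compactness yields r - u >= c > 0
   and the bound is exp(- n c^2 / 4). Summed over k this is O(rho) + O(1/n),
   uniformly over all samples, so the infimum of the admissible values of delta_n
   tends to 0. *)

Require Import Defs.
From mathcomp Require Import all_boot all_order all_algebra.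
From mathcomp Require Import all_classical all_reals all_analysis.
From mathcomp Require Import ring lra.
Import Order.TTheory GRing.Theory Num.Theory.
Import numFieldNormedType.Exports.
Local Open Scope classical_set_scope.
Local Open Scope ring_scope.

(** * Chernoff estimates at separated levels *)

(* In each case (left tail, right tail, bulk) a binomial count with success
   probability [r] rarely falls below the proportion [u] of the trials. *)
Definition levels_apart {R : realType} (rho c u r : R) : Prop :=
  [\/ u <= rho * r, 1 - r <= rho * (1 - u) | c <= r - u].

(** Complementation swaps the two tail cases and keeps the bulk case; this reduces downward
    deviations to upward ones. *)
Lemma levels_apart_compl {R : realType} (rho c u r : R) :
  levels_apart rho c u r -> levels_apart rho c (1 - r) (1 - u).
Proof.
rewrite /levels_apart => -[h|h|h].
- by apply: Or32; lra.
- by apply: Or31; lra.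
- by apply: Or33; lra.
Qed.

Lemma expR1_le4 (R : realType) : expR 1 <= 4 :> R.
Proof.
have h : 1 / 2 <= expR (- (1 / 2)) :> R.
  by apply: le_trans (expR_ge1Dx _); lra.
have h0 : 0 < expR (1 / 2) :> R by exact: expR_gt0.
have h2 : expR (1 / 2) <= 2 :> R.
  have e : expR (1 / 2) * expR (- (1 / 2)) = 1 :> R by rewrite expRN divff ?gt_eqF.
  nra.
have -> : 1 = 1 / 2 + 1 / 2 :> R by lra.
rewrite expRD; nra.
Qed.

(** Combines [expR (- s) <= 1 / (1 + s)] with [(1 + s) (1 - s + s^2) = 1 + s^3 >= 1]. *)
Lemma expR_opp_le {R : realType} (s : R) : 0 <= s ->
  expR (- s) <= 1 - s + s ^+ 2.
Proof.
move=> s0; have h1 : 1 + s <= expR s by exact: expR_ge1Dx.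
have e0 : 0 < expR (- s) by exact: expR_gt0.
have e : expR s * expR (- s) = 1 by rewrite expRN divff ?gt_eqF ?expR_gt0.
have h : (1 + s) * expR (- s) <= 1 by rewrite -[leRHS]e ler_wpM2r // ltW.
have h2 : 1 <= (1 + s) * (1 - s + s ^+ 2).
  have := exprn_ge0 3 s0; rewrite expr2 !exprS expr0 mulr1; nra.
have s1 : 0 < 1 + s by lra.
by rewrite -(ler_pM2l s1) (le_trans h h2).
Qed.

Lemma expr_le_expR {R : realType} (x : R) n : 0 <= 1 + x ->
  (1 + x) ^+ n <= expR (n%:R * x).
Proof.
by move=> x0; rewrite expRM_natl lerXn2r ?nnegrE ?expR_ge0 ?expR_ge1Dx.
Qed.

(** The three cases are added up so that one expression serves them all; for [1 <= k <= n] it is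
    symmetric under [k -> n + 1 - k]. *)
Definition deviation_bound {R : realType} (rho c : R) (n k : nat) : R :=
  (8 * rho) ^+ k + (8 * rho) ^+ (n.+1 - k) + expR (- (n%:R * c ^+ 2 / 4)).

Lemma chernoff_levels_apart {R : realType} (rho c r : R) (n k : nat) :
  0 < rho <= 1 -> 0 < c -> (1 <= k <= n)%N -> 0 <= r <= 1 ->
  levels_apart rho c (k%:R / n.+1%:R) r ->
  exists2 z : R, 0 < z <= 1 &
    (1 - r + z * r) ^+ n / z ^+ k.-1 <= deviation_bound rho c n k.
Proof.
move=> /andP[rho0 rho1] c0 /andP[k1 kn] /andP[r0 r1].
have N0 : 0 < n.+1%:R :> R by rewrite ltr0n.
have k0 : 1 <= k%:R :> R by rewrite ler1n.
have nE : n.+1%:R = n%:R + 1 :> R by rewrite -natr1.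
have n1 : 1 <= n%:R :> R by rewrite ler1n (leq_trans k1).
have knR : k%:R <= n%:R :> R by rewrite ler_nat.
have k'E : k.-1%:R = k%:R - 1 :> R by rewrite -[in RHS](prednK k1) -natr1 addrK.
have p1 : 0 <= (8 * rho) ^+ k by apply: exprn_ge0; lra.
have p2 : 0 <= (8 * rho) ^+ (n.+1 - k) by apply: exprn_ge0; lra.
have p3 := expR_ge0 (- (n%:R * c ^+ 2 / 4)).
set u := k%:R / n.+1%:R.
have uN : u * (n%:R + 1) = k%:R by rewrite -nE /u mulfVK ?gt_eqF.
have u0 : 0 < u by rewrite divr_gt0 //; lra.
have u1 : u <= 1 by rewrite /u ler_pdivrMr // mul1r; lra.
rewrite /deviation_bound => -[h|h|h].
(* The Chernoff parameter z is 1/2, rho, and e^(-c/2) respectively. *)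
- exists (1 / 2); first lra.
  suff : (1 - r + 1 / 2 * r) ^+ n / (1 / 2) ^+ k.-1 <= (8 * rho) ^+ k by lra.
  have A : (1 - r + 1 / 2 * r) ^+ n <= expR (n%:R * (- (r / 2))).
    have -> : 1 - r + 1 / 2 * r = 1 + (- (r / 2)) by lra.
    by apply: expr_le_expR; lra.
  (* Here [n r >= n u / rho >= k / (2 rho)], because [n / (n + 1) >= 1 / 2]; then [expR x >= x] at
     [x = 1 / (4 rho)] gives the base [4 rho]. *)
  have B : expR (n%:R * (- (r / 2))) <= (4 * rho) ^+ k.
    apply: (@le_trans _ _ (expR (k%:R * (- (4 * rho)^-1)))).
      rewrite ler_expR -(ler_pM2r (x := 4 * rho)); last lra.
      rewrite !mulrN !mulNr lerN2 -[k%:R / _ * _]mulrA mulVf ?mulr1; last first.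
        by rewrite gt_eqF; lra.
      nra.
    rewrite expRM_natl lerXn2r ?nnegrE ?expR_ge0 //; first lra.
    rewrite expRN invf_ple ?posrE ?expR_gt0 //; last lra.
    by have := expR_ge1Dx (4 * rho)^-1; lra.
  have C : ((1 / 2) ^+ k.-1)^-1 <= 2 ^+ k :> R.
    rewrite -exprVn div1r invrK ler_weXn2l ?leq_pred //; lra.
  have -> : 8 * rho = (4 * rho) * 2 by lra.
  rewrite [leRHS]exprMn ler_pM ?invr_ge0 ?exprn_ge0 //; lra.
- exists rho; first by rewrite rho0.
  suff : (1 - r + rho * r) ^+ n / rho ^+ k.-1 <= (8 * rho) ^+ (n.+1 - k) by lra.
  rewrite ler_pdivrMr ?exprn_gt0 //.
  have mE : (n.+1 - k)%:R = n%:R + 1 - k%:R :> R by rewrite natrB ?nE // leqW.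
  have A : 1 - r + rho * r <= rho * (1 + (1 - u)) by nra.
  apply: (@le_trans _ _ (rho ^+ n * (1 + (1 - u)) ^+ n)).
    by rewrite -exprMn lerXn2r ?nnegrE //; nra.
  (* Uses [n (1 - u) = n (n + 1 - k) / (n + 1) <= n + 1 - k]. *)
  have B : (1 + (1 - u)) ^+ n <= 8 ^+ (n.+1 - k).
    apply: le_trans (expr_le_expR _ _ _) _; first lra.
    apply: (@le_trans _ _ (expR ((n.+1 - k)%:R * 1))).
      by rewrite ler_expR mE; nra.
    rewrite expRM_natl lerXn2r ?nnegrE ?expR_ge0 //.
    by have := expR1_le4 R; lra.
  have -> : (8 * rho) ^+ (n.+1 - k) * rho ^+ k.-1 = rho ^+ n * 8 ^+ (n.+1 - k).
    rewrite exprMn -mulrA -exprD mulrC; congr (rho ^+ _ * _).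
    by rewrite -subn1 addnBA // subnK ?subn1 // leqW.
  by rewrite ler_wpM2l ?exprn_ge0 // ltW.
- have E0 := expR_gt0 (- (c / 2)).
  exists (expR (- (c / 2))).
    by rewrite E0 -[leRHS]expR0 ler_expR /= oppr_le0; lra.
  suff : (1 - r + expR (- (c / 2)) * r) ^+ n / expR (- (c / 2)) ^+ k.-1 <=
    expR (- (n%:R * c ^+ 2 / 4)) by lra.
  have E := @expR_opp_le R (c / 2) _.
  rewrite ler_pdivrMr ?exprn_gt0 // -expRM_natl -expRD.
  have -> : 1 - r + expR (- (c / 2)) * r = 1 + (expR (- (c / 2)) - 1) * r.
    by ring.
  have E' : expR (- (c / 2)) <= 1 - c / 2 + (c / 2) ^+ 2 by apply: E; lra.
  apply: le_trans (expr_le_expR _ _ _) _; first nra.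
  rewrite ler_expR k'E.
  have D : (expR (- (c / 2)) - 1) * r <= - (c / 2) * r + c ^+ 2 / 4.
    have : (expR (- (c / 2)) - 1) * r <= (- (c / 2) + (c / 2) ^+ 2) * r.
      by apply: ler_wpM2r => //; lra.
    have : c ^+ 2 * r <= c ^+ 2 by rewrite ler_piMr // sqr_ge0.
    rewrite !expr2; nra.
  have D2 : n%:R * ((expR (- (c / 2)) - 1) * r) <=
     n%:R * (- (c / 2) * r + c ^+ 2 / 4) by rewrite ler_wpM2l //; lra.
  apply: le_trans D2 _.
  (* Since [u <= 1], [n u = k - u >= k - 1]; the total exponent is then at most [n (c^2 / 4 - c (r -
     u) / 2) <= - n c^2 / 4]. *)
  have D3 : k%:R - 1 <= n%:R * u by lra.
  have : n%:R * (c * (c + u - r)) <= 0.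
    by apply: mulr_ge0_le0; [lra | apply: mulr_ge0_le0; lra].
  rewrite !expr2; nra.
Qed.

(** * Number of sample points in a set *)

Lemma measure_le_fin_sum {d} {T : measurableType d} {R : realType}
  (P : probability T R) (I : finType) (Q : pred I) (A : set T) (F : I -> set T) :
  measurable A -> (forall i, Q i -> measurable (F i)) ->
  A `<=` \bigcup_(i in [set` Q]) F i ->
  (P A <= \sum_(i | Q i) P (F i))%E.
Proof.
move=> mA mF AF.
rewrite (bigfs _ (index_enum_uniq I)); last first.
  by move=> i _; rewrite mem_index_enum.
exact: content_sub_fsum.
Qed.

Definition occupancy {T R : Type} {n : nat} (X : 'I_n -> T -> R) (B : set R)
  (w : T) : nat := #|[pred i | X i w \in B]|.

(** The intersection runs over all indices, with complements off [S], so that mutual independence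
    applies to it directly. *)
Definition hit_pattern {T R : Type} {n : nat} (X : 'I_n -> T -> R) (B : set R)
    (S : {set 'I_n}) : set T :=
  \bigcap_(i in [set` [set: 'I_n]%SET]) X i @^-1` (if i \in S then B else ~` B).

(** Splitting by the exact set of hits gives a finite union whose pieces have explicit product
    probabilities. *)
Lemma occupancy_ltE {T R : Type} {n : nat} (X : 'I_n -> T -> R) (B : set R) k :
  [set w | (occupancy X B w < k)%N] =
  \bigcup_(S in [set` [pred S : {set 'I_n} | (#|S| < k)%N]]) hit_pattern X B S.
Proof.
apply/seteqP; split=> [w /= wk|w [S /= Sk] wS /=].
  exists [set i | X i w \in B]%SET.
    rewrite /= inE (leq_trans _ wk) // ltnS subset_leq_card //.
    by apply/fintype.subsetP => i; rewrite !inE.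
  move=> i _; rewrite /preimage/= inE; case: ifPn => [|/negP h].
    by rewrite inE.
  by move=> Bi; apply: h; rewrite inE.
rewrite inE in Sk.
apply: leq_ltn_trans Sk; apply/subset_leq_card/fintype.subsetP => i.
rewrite inE => Bi.
by have := wS i; rewrite /preimage/= inE; case: ifPn => // _ /(_ isT).
Qed.

Section occupancy.
Context {d} {T : measurableType d} {R : realType} {P : probability T R}
  {n : nat}.
Implicit Types (X : 'I_n -> {RV P >-> R}) (B : set R).

Lemma measurable_hit_pattern X B (S : {set 'I_n}) : measurable B ->
  measurable (hit_pattern X B S).
Proof.
move=> mB; apply: fin_bigcap_measurable => // i _.
rewrite -[_ @^-1` _]setTI; apply: measurable_funPT => //.
by case: ifP => // _; exact: measurableC.
Qed.

Lemma measurable_occupancy_lt X B k : measurable B ->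
  measurable [set w | (occupancy X B w < k)%N].
Proof.
move=> mB; rewrite occupancy_ltE; apply: fin_bigcup_measurable => // S _.
exact: measurable_hit_pattern.
Qed.

Lemma probability_hit_pattern mu X B (S : {set 'I_n}) : iid_sample mu X ->
  measurable B ->
  P (hit_pattern X B S) =
  (\prod_i (if i \in S then fine (mu B) else 1 - fine (mu B)))%:E.
Proof.
move=> [indep law] mB; rewrite /hit_pattern.
have mS i : measurable (if i \in S then B else ~` B).
  by case: ifP => // _; exact: measurableC.
rewrite (indep [set: 'I_n]%SET (fun i => if i \in S then B else ~` B)) //.
rewrite -prodEFin; apply: eq_big => [i|i _]; first by rewrite inE.
have -> : P (X i @^-1` (if i \in S then B else ~` B)) =
    distribution P (X i) (if i \in S then B else ~` B) by [].
rewrite law //; case: ifP => _; first by rewrite fineK ?fin_num_measure.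
by rewrite probability_setC // EFinB fineK ?fin_num_measure.
Qed.

Lemma occupancy_chernoff mu X B k (z : R) : iid_sample mu X -> measurable B ->
  0 < z <= 1 ->
  (P [set w | (occupancy X B w < k)%N] <=
   ((1 - fine (mu B) + z * fine (mu B)) ^+ n / z ^+ k.-1)%:E)%E.
Proof.
move=> iid mB /andP[z0 z1]; set r := fine (mu B).
have r0 : 0 <= r by apply: fine_ge0.
have r1 : r <= 1 by rewrite -lee_fin fineK ?fin_num_measure ?probability_le1.
apply: le_trans.
  apply: (measure_le_fin_sum P _ [pred S : {set 'I_n} | (#|S| < k)%N] _
    (hit_pattern X B)).
  - exact: measurable_occupancy_lt.
  - by move=> S _; exact: measurable_hit_pattern.
  - by rewrite occupancy_ltE.
under eq_bigr do rewrite (probability_hit_pattern _ _ _ _ iid mB) -/r.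
rewrite sumEFin lee_fin ler_pdivlMr ?exprn_gt0 // mulr_suml.
(* Weighting each pattern by z^(#|S| - k + 1) >= 1 turns the sum into a binomial
   expansion. *)
have -> : (1 - r + z * r) ^+ n =
    \sum_(S : {set 'I_n}) \prod_(i < n) (if i \in S then z * r else 1 - r).
  have <- : \prod_(i < n) (z * r + (1 - r)) = (1 - r + z * r) ^+ n.
    by rewrite prodr_const card_ord addrC.
  by rewrite bigA_distr.
rewrite [leRHS](bigID [pred S : {set 'I_n} | (#|S| < k)%N]) /=.
rewrite -[leLHS]addr0 lerD //; last first.
  apply: sumr_ge0 => S _; apply: prodr_ge0 => i _.
  by case: ifP => _; rewrite ?mulr_ge0 ?subr_ge0 // ltW.
apply: ler_sum => S Sk.
have -> : \prod_(i < n) (if i \in S then z * r else 1 - r) =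
    (\prod_(i < n) (if i \in S then r else 1 - r)) * z ^+ #|S|.
  rewrite -prodr_const [X in _ = _ * X]big_mkcond /= -big_split /=.
  apply: eq_bigr => i _.
  by case: ifP; rewrite ?mulr1 // mulrC.
apply: ler_wpM2l.
  by apply: prodr_ge0 => i _; case: ifP => _ //; rewrite subr_ge0.
by rewrite ler_wiXn2l // ?ltW //; case: k Sk.
Qed.

End occupancy.

(** * Order statistics in terms of counts *)

(* The ray is ]-oo, t[ for [b = true] and ]-oo, t] for [b = false]. *)
Lemma order_statistic_in_ray {T : Type} {R : realType} {n : nat}
  (X : 'I_n -> T -> R) k b (t : R) (w : T) : (1 <= k <= n)%N ->
  (order_statistic (X^~ w) k \in Interval -oo%O (BSide b t)) =
  (k <= occupancy X [set` Interval -oo%O (BSide b t)] w)%N.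
Proof.
move=> /andP[k1 kn]; rewrite /order_statistic; set s := sort _ _.
have ss : sorted <=%O s by exact: sort_le_sorted.
have sz : size s = n by rewrite size_sort size_codom card_ord.
(* Sorting preserves counts, and the entries in the ray come first in [s]; it remains to compare
   their number with the index [k - 1], counted from 0. *)
have -> : occupancy X [set` Interval -oo%O (BSide b t)] w =
    count (mem (Interval -oo%O (BSide b t))) s.
  rewrite count_sort codomE count_map enumT /occupancy cardE /enum_mem.
  rewrite size_filter.
  by apply: eq_count => i /=; rewrite !inE mem_setE.
case: b; rewrite in_itv /=.
- rewrite (@eq_count _ _ (< t)); last by move=> y /=; rewrite in_itv.
  case: leqP => kc; first by apply: nth_count_lt => //; rewrite prednK.
  apply/negbTE; rewrite -leNgt; apply: nth_count_ge => //.
  by rewrite sz prednK // kn andbT -ltnS prednK.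
- rewrite (@eq_count _ _ (<= t)); last by move=> y /=; rewrite in_itv.
  case: leqP => kc; first by apply: nth_count_le => //; rewrite prednK.
  apply/negbTE; rewrite -ltNge; apply: nth_count_gt => //.
  by rewrite sz prednK // kn andbT -ltnS prednK.
Qed.

Lemma occupancyC {T R : Type} {n : nat} (X : 'I_n -> T -> R) (B : set R) w :
  (occupancy X B w + occupancy X (~` B) w)%N = n.
Proof.
rewrite -[RHS]card_ord -(cardC [pred i | X i w \in B]); congr (_ + _)%N.
by apply: eq_card => i; rewrite !inE /= in_setC.
Qed.

(** * Consequences of continuity and the tail conditions *)

Section tails.
Context {R : realType} {F : R -> R}.
Context (F_continuous : continuous F) (F_increasing : {homo F : s t / s < t})
  (F01 : forall t, 0 <= F t <= 1)
  (F_right_tail : forall eps : R, 0 < eps ->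
    (1 - F (t + eps)) / (1 - F t) @[t --> +oo] --> (0 : R))
  (F_left_tail : forall eps : R, 0 < eps ->
    F t / F (t + eps) @[t --> -oo] --> (0 : R)).

Lemma cdf_strict_bounds t : 0 < F t < 1.
Proof.
have /andP[a _] := F01 (t - 1); have /andP[_ b] := F01 (t + 1).
have c : F (t - 1) < F t by apply: F_increasing; lra.
have d : F t < F (t + 1) by apply: F_increasing; lra.
lra.
Qed.

Lemma right_tail_le (eps rho : R) : 0 < eps -> 0 < rho ->
  exists A, forall t, A < t -> 1 - F (t + eps) <= rho * (1 - F t).
Proof.
move=> e0 r0; have /cvgr0Pnorm_le/(_ rho r0)[A [_ hA]] := F_right_tail eps e0.
exists A => t /hA /=.
have := cdf_strict_bounds t; have := cdf_strict_bounds (t + eps) => h1 h2.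
rewrite ger0_norm; last by rewrite divr_ge0 //; lra.
by rewrite ler_pdivrMr //; lra.
Qed.

Lemma left_tail_le (eps rho : R) : 0 < eps -> 0 < rho ->
  exists A, forall t, t < A -> F t <= rho * F (t + eps).
Proof.
move=> e0 r0; have /cvgr0Pnorm_le/(_ rho r0)[A [_ hA]] := F_left_tail eps e0.
exists A => t /hA /=.
have := cdf_strict_bounds t; have := cdf_strict_bounds (t + eps) => h1 h2.
rewrite ger0_norm; last by rewrite divr_ge0 //; lra.
by rewrite ler_pdivrMr //; lra.
Qed.

(** Beyond [A] and before [B] the tail conditions apply; on the compact interval between, the
    continuous positive increment [F (t + eps) - F t] attains its minimum [c]. *)
Lemma levels_apart_shift (eps rho : R) : 0 < eps -> 0 < rho ->
  exists2 c, 0 < c & forall t, levels_apart rho c (F t) (F (t + eps)).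
Proof.
move=> e0 r0.
have [A hA] := right_tail_le eps rho e0 r0.
have [B hB] := left_tail_le eps rho e0 r0.
(* The maximum keeps [[B, b]] nonempty even when [A < B]. *)
pose b := Order.max A B.
have cont : {within `[B, b], continuous (fun t => F (t + eps) - F t)}.
  apply: continuous_subspaceT => t.
  apply: continuousB; last exact: F_continuous.
  apply: (continuous_comp (f := fun t : R => t + eps) (g := F)); last first.
    exact: F_continuous.
  by apply: continuousD; [exact: cvg_id | exact: cvg_cst].
have Bb : B <= b by rewrite le_max lexx orbT.
have [m _ hm] := EVT_min Bb cont.
exists (F (m + eps) - F m).
  by rewrite subr_gt0 F_increasing // ltrDl.
move=> t; case: (ltP t B) => [/hB|Bt]; first exact: Or31.
case: (leP t b) => [tb|bt].
  by apply: Or33; apply: hm; rewrite in_itv /= Bt.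
by apply: Or32; apply: hA; rewrite (le_lt_trans _ bt) // le_max lexx.
Qed.

(* Each tail condition already forces F to approach 1, respectively 0, so that
   the intermediate value theorem applies. *)
Lemma pinv_cdfK (u : R) : 0 < u < 1 -> F (pinv [set: R] F u) = u.
Proof.
move=> /andP[u0 u1]; apply: pinvK; rewrite inE.
have u1' : 0 < 1 - u by lra.
(* With the targets as rates, a single shift by 1 suffices: [1 - F s < 1] gives
   [1 - F (s + 1) <= 1 - u] on the right, and [F (s + 1) < 1] gives [F s <= u] on the left. *)
have [A hA] := right_tail_le 1 (1 - u) ltr01 u1'.
have [B hB] := left_tail_le 1 u ltr01 u0.
have Ab : F (Order.max A B + 2) >= u.
  have := hA (Order.max A B + 1).
  rewrite (_ : _ + 1 + 1 = Order.max A B + 2); last ring.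
  have -> : A < Order.max A B + 1.
    by rewrite (@le_lt_trans _ _ (Order.max A B)) ?le_max ?lexx // ltrDl.
  move/(_ isT); have := cdf_strict_bounds (Order.max A B + 1); nra.
have Bb : F (B - 1) <= u.
  have := hB (B - 1); have -> : B - 1 < B by lra.
  move/(_ isT); have := cdf_strict_bounds (B - 1 + 1); nra.
have BA : B - 1 <= Order.max A B + 2.
  apply: (@le_trans _ _ (Order.max A B)); last lra.
  by rewrite le_max; apply/orP; right; lra.
have [||c _ <-] := @IVT R F (B - 1) (Order.max A B + 2) u BA; last by exists c.
  by apply: continuous_subspaceT => t; exact: F_continuous.
by rewrite ge_min le_max Bb Ab /= orbT.
Qed.

End tails.

(** * Finite sums and suprema over the indices *)

Lemma sum_exp_le {R : realType} (a : R) n : 0 <= a <= 1 / 2 ->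
  \sum_(i < n) a ^+ i.+1 <= 2 * a.
Proof.
move=> /andP[a0 a1]; elim: n => [|n ih]; first by rewrite big_ord0; lra.
rewrite big_ord_recl /= expr1.
under eq_bigr do rewrite /bump /= add1n exprS.
rewrite -mulr_sumr.
have : a * (\sum_(i < n) a ^+ i.+1) <= a * (2 * a) by rewrite ler_wpM2l.
nra.
Qed.

Lemma sum_deviation_bound {R : realType} (rho c : R) n : (1 <= n)%N ->
  0 < rho <= 1 / 16 -> 0 < c ->
  \sum_(i < n) deviation_bound rho c n i.+1 <= 32 * rho + 32 / (n%:R * c ^+ 4).
Proof.
move=> n1 /andP[rho0 rho1] c0.
have n0 : 0 < n%:R :> R by rewrite ltr0n.
have c4 : 0 < c ^+ 4 by rewrite exprn_gt0.
rewrite /deviation_bound 2!big_split /= sumr_const card_ord.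
have h1 : \sum_(i < n) (8 * rho) ^+ i.+1 <= 2 * (8 * rho).
  by apply: sum_exp_le; lra.
have h2 : \sum_(i < n) (8 * rho) ^+ (n.+1 - i.+1) <= 2 * (8 * rho).
  rewrite (reindex_inj rev_ord_inj) /=.
  under eq_bigr => i _ do rewrite subSS subKn //.
  exact: h1.
(* With [x = n c^2 / 4], [expR x >= x^2 / 2] gives [n expR (- x) <= 2 n / x^2 = 32 / (n c^4)]. *)
have h3 : expR (- (n%:R * c ^+ 2 / 4)) *+ n <= 32 / (n%:R * c ^+ 4).
  set x := n%:R * c ^+ 2 / 4.
  have x0 : 0 < x by rewrite divr_gt0 ?mulr_gt0 ?exprn_gt0.
  have := expR_ge1Dxn 1 (ltW x0); rewrite (_ : 2`!%:R = 2) // => hx.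
  have e0 := expR_gt0 x.
  have x2 : x ^+ 2 * 16 = n%:R * (n%:R * c ^+ 4) by rewrite /x; field.
  rewrite expRN -[_ *+ n]mulr_natl ler_pdivlMr ?mulr_gt0 // mulrAC -x2.
  rewrite ler_pdivrMr //.
  lra.
lra.
Qed.

Lemma sup_image_le {R : realType} {n : nat} (f : nat -> R) (e : R) :
  (1 <= n)%N ->
  (sup [set f k | k in [set k | (1 <= k <= n)%N]] <= e) <->
  (forall i : 'I_n, f i.+1 <= e).
Proof.
move=> n1; split=> [h i|h].
  apply: le_trans h; apply: ub_le_sup; last first.
    by exists i.+1 => //=; exact: ltn_ord.
  (* A crude upper bound: [sup] of an unbounded set would be a default value. *)
  exists (\sum_(i < n) `|f i.+1|) => _ [k /= /andP[k1 kn] <-].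
  rewrite -(prednK k1) in kn *.
  rewrite (bigD1 (Ordinal kn)) //= (le_trans (ler_norm _)) // lerDl.
  exact: sumr_ge0.
apply: ge_sup; first by exists (f 1), 1%N => //=; rewrite n1.
move=> _ [k /= /andP[k1 kn] <-]; rewrite -(prednK k1) in kn *.
exact: (h (Ordinal kn)).
Qed.

(** * Deviation of a single order statistic *)

Section deviation.
Context {R : realType} (mu : probability (measurableTypeR R) R).

Lemma cdf_bounds t : 0 <= cdf_of mu t <= 1.
Proof.
apply/andP; split; first exact: fine_ge0.
by rewrite -lee_fin /cdf_of fineK ?fin_num_measure ?probability_le1.
Qed.

Context {d} {T : measurableType d} {P : probability T R} {n : nat}
  (X : 'I_n -> {RV P >-> R}).

Definition large_deviation (k : nat) (e : R) : set T :=
  [set w | e < `|order_statistic (fun i => X i w) k -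
                 inverse_cdf mu (k%:R / n.+1%:R)|].

Lemma large_deviationE k e : (1 <= k <= n)%N ->
  large_deviation k e =
  [set w |
    (occupancy X `]-oo, (inverse_cdf mu (k%:R / n.+1%:R) + e)%R] w < k)%N]
  `|` ~` [set w |
    (occupancy X `]-oo, (inverse_cdf mu (k%:R / n.+1%:R) - e)%R[ w < k)%N].
Proof.
move=> kn; rewrite /large_deviation; set q := inverse_cdf _ _.
have up w := order_statistic_in_ray X k false (q + e) w kn.
have lo w := order_statistic_in_ray X k true (q - e) w kn.
apply/seteqP; split => w /=.
  rewrite lter_normr => /orP[h|h]; [left|right].
    by rewrite ltnNge -up in_itv /= -ltNge; lra.
  by apply/negP; rewrite -leqNgt -lo in_itv /=; lra.
rewrite lter_normr => -[|/negP].
  by rewrite ltnNge -up in_itv /= -ltNge => h; apply/orP; left; lra.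
by rewrite -leqNgt -lo in_itv /= => h; apply/orP; right; lra.
Qed.

Lemma measurable_large_deviation k e : (1 <= k <= n)%N ->
  measurable (large_deviation k e).
Proof.
move=> kn; rewrite large_deviationE //.
by apply: measurableU; [|apply: measurableC]; exact: measurable_occupancy_lt.
Qed.

(** Chernoff's bound is used twice: with levels [F q] and [F (q + e)] upwards and, after
    complementation, with [1 - F q] and [1 - F (q - e)] downwards. *)
Lemma large_deviation_probability k e rho c : (1 <= k <= n)%N ->
  iid_sample mu X -> 0 < rho <= 1 -> 0 < c ->
  (forall t, levels_apart rho c (cdf_of mu t) (cdf_of mu (t + e))) ->
  cdf_of mu (inverse_cdf mu (k%:R / n.+1%:R)) = k%:R / n.+1%:R ->
  (P (large_deviation k e) <= (2 * deviation_bound rho c n k)%:E)%E.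
Proof.
move=> kn iid rho01 c0 apart; set q := inverse_cdf _ _ => qE.
have /andP[k1 kn'] := kn.
have k'n : (1 <= n.+1 - k <= n)%N.
  by rewrite subn_gt0 ltnS kn' leq_subLR -addn1 addnC leq_add2r.
have mup : measurable [set w | (occupancy X `]-oo, (q + e)%R] w < k)%N].
  exact: measurable_occupancy_lt.
have mlo : measurable [set w |
    (occupancy X (~` `]-oo, (q - e)%R]) w < n.+1 - k)%N].
  by apply: measurable_occupancy_lt; exact: measurableC.
(* The open ray at [q - e] is enlarged to the closed one, whose measure is a value of the
   distribution function; [k] points in it leave at most [n - k] outside. *)
apply: (@le_trans _ _ (P ([set w | (occupancy X `]-oo, (q + e)%R] w < k)%N] `|`
    [set w | (occupancy X (~` `]-oo, (q - e)%R]) w < n.+1 - k)%N]))).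
  apply: le_measure; rewrite ?inE.
  - exact: measurable_large_deviation.
  - exact: measurableU.
  rewrite large_deviationE // -/q; apply: setUS => w /= /negP.
  rewrite -leqNgt => h.
  have := occupancyC X `]-oo, (q - e)%R] w.
  have : (k <= occupancy X `]-oo, (q - e)%R] w)%N.
    apply: leq_trans h _; apply/subset_leq_card/fintype.subsetP => i.
    by rewrite !inE /= !in_itv /=; exact: ltW.
  by move=> h1 h2; rewrite ltn_subRL -[X in (_ < X.+1)%N]h2 ltnS leq_add2r.
apply: (le_trans (measureU2 P mup mlo)).
have -> : 2 * deviation_bound rho c n k =
    deviation_bound rho c n k + deviation_bound rho c n (n.+1 - k).
  by rewrite /deviation_bound subKn ?leqW //; ring.
rewrite EFinD; apply: leeD.
  have [|z z01 zb] := chernoff_levels_apart rho c (cdf_of mu (q + e)) n k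
    rho01 c0 kn (cdf_bounds _).
    by rewrite -qE; exact: apart.
  exact: (le_trans (occupancy_chernoff _ _ _ _ _ iid _ z01)).
have FC : fine (mu (~` `]-oo, (q - e)%R])) = 1 - cdf_of mu (q - e).
  by rewrite probability_setC // fineB ?fin_num_measure.
have FCb : 0 <= 1 - cdf_of mu (q - e) <= 1 by have := cdf_bounds (q - e); lra.
have [|z z01 zb] := chernoff_levels_apart rho c (1 - cdf_of mu (q - e)) n
    (n.+1 - k) rho01 c0 k'n FCb.
  have -> : (n.+1 - k)%:R / n.+1%:R = 1 - cdf_of mu q :> R.
    by rewrite qE natrB ?leqW // mulrBl divff // pnatr_eq0.
  apply: levels_apart_compl.
  by rewrite -[in cdf_of mu q](subrK e q); exact: apart.
apply: (le_trans (occupancy_chernoff _ _ _ _ _ iid _ z01)) => //.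
  exact: measurableC.
by rewrite FC lee_fin.
Qed.

End deviation.

(** * Admissible deviations and the choice of [delta] *)

Definition uniformly_close {R : realType}
    (mu : probability (measurableTypeR R) R)
    (n : nat) (e : R) : Prop :=
  forall (d : measure_display) (T : measurableType d) (P : probability T R)
    (X : 'I_n -> {RV P >-> R}), iid_sample mu X ->
  ((1 - e)%:E <=
   P (~` \bigcup_(i in [set` predT : pred 'I_n]) large_deviation mu X i.+1 e))%E.

Lemma close_setE {R : realType} (mu : probability (measurableTypeR R) R)
  {d : measure_display} {T : measurableType d} {P : probability T R} {n : nat}
  (X : 'I_n -> {RV P >-> R}) (e : R) : (1 <= n)%N ->
  [set w : T | sup [set `|order_statistic (fun i => X i w) k -
                     inverse_cdf mu (k%:R / n.+1%:R)|
                   | k in [set k : nat | (1 <= k <= n)%N]] <= e] =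
  ~` \bigcup_(i in [set` predT : pred 'I_n]) large_deviation mu X i.+1 e.
Proof.
move=> n1; apply/seteqP; split => w /=.
  by move/(sup_image_le _ _ n1) => h [i _]; rewrite /large_deviation/= ltNge h.
move=> h; apply/(sup_image_le _ _ n1) => i; rewrite leNgt; apply/negP => hi.
by apply: h; exists i.
Qed.

Lemma measurable_bigcup_large_deviation {R : realType}
  (mu : probability (measurableTypeR R) R)
  {d : measure_display} {T : measurableType d} {P : probability T R} {n : nat}
  (X : 'I_n -> {RV P >-> R}) (e : R) :
  measurable
    (\bigcup_(i in [set` predT : pred 'I_n]) large_deviation mu X i.+1 e).
Proof.
apply: fin_bigcup_measurable => // i _; apply: measurable_large_deviation.
exact: ltn_ord.
Qed.

(** A larger [e] shrinks the deviation events and lowers the required probability; hence everything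
    above the infimum of admissible values is admissible. *)
Lemma uniformly_close_mono {R : realType}
  (mu : probability (measurableTypeR R) R)
  n (e e' : R) : e <= e' -> uniformly_close mu n e -> uniformly_close mu n e'.
Proof.
move=> ee h d T P X iid.
apply: (@le_trans _ _ (1 - e)%:E); first by rewrite lee_fin lerD2l lerN2.
apply: (le_trans (h _ _ _ _ iid)); apply: le_measure; rewrite ?inE.
1, 2: by apply: measurableC; exact: measurable_bigcup_large_deviation.
apply: subsetC => w [i _ hi]; exists i => //; exact: le_lt_trans ee hi.
Qed.

Lemma uniformly_close1 {R : realType}
  (mu : probability (measurableTypeR R) R) n : uniformly_close mu n 1.
Proof. by move=> d T P X iid; rewrite subrr. Qed.

Lemma eventually_close {R : realType} (mu : probability (measurableTypeR R) R)
  (F_continuous : continuous (cdf_of mu))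
  (F_increasing : {homo cdf_of mu : s t / s < t})
  (F_right_tail : forall eps : R, 0 < eps ->
     (1 - cdf_of mu (t + eps)) / (1 - cdf_of mu t) @[t --> +oo] --> (0 : R))
  (F_left_tail : forall eps : R, 0 < eps ->
     cdf_of mu t / cdf_of mu (t + eps) @[t --> -oo] --> (0 : R)) (e : R) :
  0 < e -> \forall n \near \oo, uniformly_close mu n e.
Proof.
(* The bound [1 / 16] serves the geometric sums; [e / 128] makes the tail part [2 * 32 * rho] at
   most [e / 2], and [n >= 128 / (e c^4)] below does the same for the bulk part. *)
move=> e0; pose rho := Order.min (1 / 16) (e / 128).
have rho0 : 0 < rho by rewrite lt_min; apply/andP; split; lra.
have rho1 : rho <= 1 / 16 by rewrite ge_min lexx.
have rhoe : rho <= e / 128 by rewrite ge_min lexx orbT.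
have [c c0 apart] := levels_apart_shift F_continuous F_increasing
  (cdf_bounds mu) F_right_tail F_left_tail e rho e0 rho0.
near=> n => d T P X iid.
have n1 : (1 <= n)%N by near: n; exists 1%N.
have nbig : 128 / (e * c ^+ 4) <= n%:R.
  by near: n; exact: nbhs_infty_ger.
rewrite probability_setC; last exact: measurable_bigcup_large_deviation.
rewrite EFinB; apply: leeB => //.
apply: le_trans.
  apply: (measure_le_fin_sum P _ predT _
    (fun i : 'I_n => large_deviation mu X i.+1 e)) => //.
    exact: measurable_bigcup_large_deviation.
  by move=> i _; apply: measurable_large_deviation; exact: ltn_ord.
apply: (@le_trans _ _ (\sum_(i < n) (2 * deviation_bound rho c n i.+1)%:E)%E).
  apply: lee_sum => i _; apply: large_deviation_probability => //.
    exact: ltn_ord.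
    by rewrite rho0 /=; lra.
  apply: pinv_cdfK => //; first exact: cdf_bounds.
  rewrite divr_gt0 ?ltr0n //= ltr_pdivrMr ?ltr0n // mul1r ltr_nat.
  by rewrite ltnS ltn_ord.
rewrite sumEFin lee_fin -mulr_sumr.
have := sum_deviation_bound rho c n n1; rewrite rho0 rho1 => /(_ isT c0).
have c4 : 0 < c ^+ 4 by rewrite exprn_gt0.
have n0 : 0 < n%:R :> R by rewrite ltr0n.
have : 32 / (n%:R * c ^+ 4) <= e / 4.
  rewrite ler_pdivrMr ?mulr_gt0 //.
  move: nbig; rewrite ler_pdivrMr ?mulr_gt0 //; lra.
lra.
Unshelve. all: by end_near. Qed.

Theorem theorem1 (R : realType) (mu : probability (measurableTypeR R) R)
  (F_continuous : continuous (cdf_of mu))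
  (F_increasing : {homo cdf_of mu : s t / s < t})
  (F_right_tail : forall eps : R, 0 < eps ->
     (1 - cdf_of mu (t + eps)) / (1 - cdf_of mu t) @[t --> +oo] --> (0 : R))
  (F_left_tail : forall eps : R, 0 < eps ->
     cdf_of mu t / cdf_of mu (t + eps) @[t --> -oo] --> (0 : R)) :
  exists delta : nat -> R,
    delta @ \oo --> (0 : R) /\
    forall n : nat, (1 <= n)%N ->
    forall (d : measure_display) (T : measurableType d) (P : probability T R)
      (X : 'I_n -> {RV P >-> R}),
      iid_sample mu X ->
      ((1 - delta n)%:E <=
       P [set w : T |
            (sup [set `|order_statistic (fun i => X i w) k -
                        inverse_cdf mu (k%:R / n.+1%:R)|
                 | k in [set k : nat | (1 <= k <= n)%N]] <= delta n)%R])%E.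
Proof.
(* All samples are quantified inside [uniformly_close], so [E n] depends only on [mu] and [n];
   positivity of its elements bounds the infimum below by 0. *)
pose E n := [set e : R | 0 < e /\ uniformly_close mu n e].
have Einf n : has_inf (E n).
  split; first by exists 1; split => //; exact: uniformly_close1.
  by exists 0 => e [/ltW].
(* The infimum need not be attained; the vanishing excess leaves room for an admissible [e] below
   [delta n]. *)
exists (fun n => inf (E n) + n.+1%:R^-1); split.
  apply/cvgr0Pnorm_le => e e0.
  have e2 : 0 < e / 2 by lra.
  near=> n.
  have h1 : inf (E n) <= e / 2.
    apply: ge_inf; first by case: (Einf n).
    split => //; near: n; exact: eventually_close.
  have h2 : n.+1%:R^-1 <= e / 2.
    near: n; have /cvgr0Pnorm_le/(_ _ e2) := @cvg_harmonic R.
    by apply: filterS => n; rewrite ger0_norm // /harmonic invr_ge0.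
  have h3 : 0 <= inf (E n).
    by apply: lb_le_inf; [case: (Einf n) | move=> x [/ltW]].
  have h4 : 0 < n.+1%:R^-1 :> R by rewrite invr_gt0 ltr0n.
  rewrite ger0_norm; last exact: addr_ge0 h3 (ltW h4).
  by rewrite [leRHS]splitr; exact: lerD.
move=> n n1 d T P X iid.
have [e [e0 he] ele] : exists2 e, E n e & e < inf (E n) + n.+1%:R^-1.
  by apply: inf_adherent => //; rewrite invr_gt0 ltr0n.
rewrite close_setE //.
exact: uniformly_close_mono (ltW ele) he _ _ _ _ iid.
Unshelve. all: by end_near. Qed.
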